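(* ČF-regularity is a fuzzy closure property: if $\theta:(X,c)\to(Y,d)$ is a ČF-homeomorphism between fuzzy closure spaces and $(X,c)$ is ČF-regular, then $(Y,d)$ is ČF-regular.
   Context: $I=[0,1]$; a fuzzy (sub)set of a non-empty set $X$ is a map $f:X\to I$, and $I^X$ is the set of all of them, ordered pointwise, with $\vee,\wedge$ pointwise supremum/infimum. $\underline 0$ is the constant $0$ fuzzy set (the empty fuzzy set); the complement is $\mathfrak{Co}(f)(x)=1-f(x)$. For $x\in X$ and $0<\lambda\le1$, the fuzzy point $x_\lambda$ has value $\lambda$ at $x$ and $0$ elsewhere; $x_\lambda\in f$ means $x_\lambda\le f$, i.e. $\lambda\le f(x)$. A fuzzy closure space is a pair $(X,c)$ with $X$ a non-empty set and $c:I^X\to I^X$ satisfying $c(\underline 0)=\underline 0$, $f\le c(f)$, and $c(f\vee g)=c(f)\vee c(g)$ for all $f,g\in I^X$ (idempotency is not required). For $\theta:X\to Y$ and $f\in I^X$, $\theta(f)(y)=\sup\{f(x):\theta(x)=y\}$ if $\theta^{-1}(y)\ne\emptyset$, and $0$ otherwise. $\theta:(X,c)\to(Y,d)$ is ČF-continuous if $\theta(c(f))\le d(\theta(f))$ for all $f\in I^X$; it is a ČF-homeomorphism if it is bijective and both $\theta$ and $\theta^{-1}$ are ČF-continuous. A fuzzy closure property is a property of fuzzy closure spaces preserved by ČF-homeomorphisms. The interior is $\operatorname{int}(f)=\mathfrak{Co}(c(\mathfrak{Co}(f)))$; $f$ is a neighborhood of a fuzzy set $k$ (in particular of a fuzzy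 point) if $k\le\operatorname{int}(f)$. $(X,c)$ is ČF-regular if for each fuzzy point $x_\lambda$ and each non-empty fuzzy set $k$ in $X$ with $x_\lambda\in\mathfrak{Co}(c(k))$ there are neighborhoods $f$ of $x_\lambda$ and $g$ of $k$ with $f\le\mathfrak{Co}(g)$. *)

(* Defs.v *)
From mathcomp Require Import all_boot all_order all_algebra interval_inference.
From mathcomp Require Import all_classical all_reals.

Set Implicit Arguments.
Unset Strict Implicit.
Unset Printing Implicit Defensive.

Import Order.TTheory GRing.Theory Num.Theory.

Local Open Scope classical_set_scope.
Local Open Scope ring_scope.

(* The order <=, and the joins and meets `|` and `&`, on fuzzy sets are those
   of the pointwise lattice structure on functions (see lefP, joinfE and meetfE
   in boolp); {i01 R} is totally ordered. *)
Definition fuzzy_set (R : realType) (X : Type) := X -> {i01 R}.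

Section FuzzySets.
Context {R : realType}.

Definition fempty {X : Type} : fuzzy_set R X := fun=> 0%:i01.

Definition fcompl {X : Type} (f : fuzzy_set R X) : fuzzy_set R X :=
  fun x => (1 - (f x)%:num)%:i01.

(* The value l = 0, which gives fempty, is excluded where fuzzy points are
   quantified over. *)
Definition fpoint {X : Type} (x : X) (l : {i01 R}) : fuzzy_set R X :=
  fun y => if `[< y = x >] then l else 0%:i01.

Section Image.
Context {X Y : Type} (theta : X -> Y) (f : fuzzy_set R X) (y : Y).

(* sup set0 = 0 (lemma sup0), so this is 0 when the fibre of y is empty. *)
Definition fimage_val : R := sup [set (f x)%:num | x in theta @^-1` [set y]].

Lemma fimage_val_ge0 : 0 <= fimage_val.
Proof.
rewrite /fimage_val; set A := [set _ | _ in _].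
have [->|/set0P[_ [x xy _]]] := eqVneq A set0; first by rewrite sup0.
apply: (@le_trans _ _ (f x)%:num) => //; apply: ub_le_sup; last by exists x.
by exists 1 => _ [z _ <-].
Qed.

Lemma fimage_val_le1 : fimage_val <= 1.
Proof.
rewrite /fimage_val; set A := [set _ | _ in _].
have [->|/set0P A0] := eqVneq A set0; first by rewrite sup0.
by apply: ge_sup => // _ [x _ <-].
Qed.

End Image.

Definition fimage {X Y : Type} (theta : X -> Y) (f : fuzzy_set R X) :
  fuzzy_set R Y :=
  fun y => Itv01 (fimage_val_ge0 theta f y) (fimage_val_le1 theta f y).

End FuzzySets.

Record fuzzyClosureSpace (R : realType) := FuzzyClosureSpace {
  fcs_sort :> Type;
  fcs_inhabited : inhabited fcs_sort;
  fcl : fuzzy_set R fcs_sort -> fuzzy_set R fcs_sort;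
  fcl0 : fcl fempty = fempty;
  fcl_ext : forall f : fuzzy_set R fcs_sort, (f <= fcl f)%O;
  fclU : forall f g : fuzzy_set R fcs_sort,
    fcl (f `|` g)%O = (fcl f `|` fcl g)%O }.

Arguments fcl {R X} : rename.

Section FuzzyClosureSpaces.
Context {R : realType}.
Implicit Types X Y : fuzzyClosureSpace R.

Definition fint {X} (f : fuzzy_set R X) : fuzzy_set R X :=
  fcompl (fcl (fcompl f)).

Definition fneighborhood {X} (f k : fuzzy_set R X) : Prop := (k <= fint f)%O.

Definition CF_continuous X Y (theta : X -> Y) : Prop :=
  forall f : fuzzy_set R X, (fimage theta (fcl f) <= fcl (fimage theta f))%O.

Definition CF_homeomorphism X Y (theta : X -> Y) : Prop :=
  exists thetaV : Y -> X,
    [/\ cancel theta thetaV, cancel thetaV theta,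
        CF_continuous theta & CF_continuous thetaV].

Definition fuzzy_closure_property (P : fuzzyClosureSpace R -> Prop) : Prop :=
  forall X Y (theta : X -> Y), CF_homeomorphism theta -> P X -> P Y.

Definition CF_regular X : Prop :=
  forall (x : X) (l : {i01 R}) (k : fuzzy_set R X),
    0 < l%:num -> k <> fempty -> (fpoint x l <= fcompl (fcl k))%O ->
    exists f g : fuzzy_set R X,
      [/\ fneighborhood f (fpoint x l), fneighborhood g k & (f <= fcompl g)%O].

End FuzzyClosureSpaces.

(* Main.v *)
(* Transport along a bijection theta is precomposition with its inverse V.
   Continuity of theta and V gives two opposite inequalities, so that
   c (f \o V) = c f \o V, and every notion occurring in regularity commutes
   with precomposition by theta and V. *)

Require Import Defs.
From mathcomp Require Import all_boot all_order all_algebra interval_inference.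
From mathcomp Require Import all_classical all_reals.

Set Implicit Arguments.
Unset Strict Implicit.
Unset Printing Implicit Defensive.

Import Order.TTheory.

(** The fibre of [theta] over [y] is the singleton of [V y], so the supremum runs over one value. *)
Lemma fimage_can (R : realType) (X Y : Type) (theta : X -> Y) (V : Y -> X)
    (f : fuzzy_set R X) :
  cancel theta V -> cancel V theta -> fimage theta f = f \o V.
Proof.
move=> thetaK VK; apply/funext => y; apply/val_inj => /=.
rewrite /fimage_val (_ : preimage _ _ = [set V y]%classic) ?image_set1 ?sup1 //.
by apply/seteqP; split=> x => [<-|->].
Qed.

Section Homeomorphism.
Context {R : realType} {X Y : fuzzyClosureSpace R}.
Variables (theta : X -> Y) (V : Y -> X).
Hypotheses (thetaK : cancel theta V) (VK : cancel V theta).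
Hypotheses (theta_cont : CF_continuous theta) (V_cont : CF_continuous V).

Lemma fcl_comp (f : fuzzy_set R X) : fcl (f \o V) = fcl f \o V.
Proof.
apply/funext => y; apply/le_anti/andP; split; last first.
  by have /lefP/(_ y) := theta_cont f; rewrite !(fimage_can _ thetaK VK).
(* Continuity of [V] is used at [f \o V], whose image under [V] is [f] again. *)
have /lefP/(_ (V y)) := V_cont (f \o V); rewrite !(fimage_can _ VK thetaK) /= VK.
by rewrite (_ : (f \o V) \o theta = f)//; apply/funext => x /=; rewrite thetaK.
Qed.

Lemma fint_comp (f : fuzzy_set R X) : fint (f \o V) = fint f \o V.
(* The complement acts on values only, so it commutes with precomposition by conversion. *)
Proof. by rewrite /fint -[fcompl (f \o V)]/(fcompl f \o V) fcl_comp. Qed.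

Lemma fneighborhood_comp (f : fuzzy_set R X) (k : fuzzy_set R Y) :
  fneighborhood f (k \o theta) -> fneighborhood (f \o V) k.
Proof.
move=> /lefP fk; apply/lefP => y; rewrite fint_comp /=.
by have := fk (V y); rewrite /= VK.
Qed.

End Homeomorphism.

Lemma fpoint_comp (R : realType) (X Y : Type) (theta : X -> Y) (V : Y -> X)
    (y : Y) (l : {i01 R}) :
  cancel theta V -> cancel V theta -> fpoint (V y) l = fpoint y l \o theta.
Proof.
move=> thetaK VK; apply/funext => x; rewrite /fpoint /=.
by congr (if _ then _ else _); apply/asboolP/asboolP => [->|<-].
Qed.

Theorem theorem7p2 (R : realType) :
  fuzzy_closure_property (@CF_regular R).
Proof.
move=> X Y theta [V [thetaK VK theta_cont V_cont]] regX y l k l_gt0 k_neq0.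
move=> /lefP yk.
(* Regularity of [X] is applied to the point and the fuzzy set pulled back along [theta]. *)
have [] := regX (V y) l (k \o theta) l_gt0.
(* Each [z] is [theta (V z)], so [k] vanishes if [k \o theta] does. *)
- move=> k0; apply: k_neq0; apply/funext => z.
  by have /(congr1 (@^~ (V z))) := k0; rewrite /= VK.
(* Here [fcl_comp] is used for the inverse homeomorphism, with [theta] and [V] exchanged. *)
- rewrite (fcl_comp VK thetaK V_cont theta_cont) (fpoint_comp y l thetaK VK).
  by apply/lefP => x; exact: yk.
move=> f [g [fx gk /lefP fg]]; exists (f \o V), (g \o V); split.
- apply: (fneighborhood_comp thetaK VK theta_cont V_cont).
  by rewrite -(fpoint_comp y l thetaK VK).
- exact: (fneighborhood_comp thetaK VK theta_cont V_cont).
- by apply/lefP => z; exact: fg.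
Qed.
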